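(* If $T$ is a tree of order $n\geq 2$, then $C_{2}(T)\leq \lfloor n/2\rfloor+1$, with equality if and only if $T\in\{P_{2},P_{3},P_{4},P_{5},S_{1,2}\}$.
   Context: $P_m$ denotes the path on $m$ vertices. For $a,b\geq 1$, the double star $S_{a,b}$ is the tree with exactly two (adjacent) non-leaf vertices, one having $a$ leaf neighbors and the other $b$ leaf neighbors. A set $S\subseteq V(G)$ is a $2$-dominating set of $G$ if every vertex $v\in V(G)\setminus S$ has at least $2$ neighbors in $S$. Two disjoint sets $A,B\subseteq V(G)$ form a $2$-coalition if neither $A$ nor $B$ is a $2$-dominating set of $G$ but $A\cup B$ is a $2$-dominating set of $G$. A $2$-coalition partition of $G$ is a partition $\Theta$ of $V(G)$ such that every set in $\Theta$ is either a $2$-dominating set of cardinality $2$ or forms a $2$-coalition with another set of $\Theta$. $C_2(G)$ is the maximum cardinality of a $2$-coalition partition of $G$. *)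

(* Defs.v *)
From mathcomp Require Import all_boot.

Set Implicit Arguments.
Unset Strict Implicit.
Unset Printing Implicit Defensive.

Record sgraph := SGraph {
  vertex :> finType;
  adj : rel vertex;
  adj_sym : symmetric adj;
  adj_irrefl : irreflexive adj }.

Definition nbrs (G : sgraph) (v : G) : {set G} := [set u | adj v u].

Definition leaf (G : sgraph) (v : G) : bool := #|nbrs v| == 1.

(* [ucycle] only asks for a closed walk without repeated vertices, which an
   edge traversed back and forth also is; a graph cycle has length at least 3. *)
Definition acyclic (G : sgraph) : Prop :=
  forall c : seq G, ucycle (@adj G) c -> size c <= 2.

Definition connected (G : sgraph) : Prop :=
  0 < #|G| /\ forall x y : G, connect (@adj G) x y.

Definition is_tree (G : sgraph) : Prop := connected G /\ acyclic G.

Definition graph_iso (G H : sgraph) : Prop :=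
  exists2 f : G -> H, bijective f & forall x y, adj (f x) (f y) = adj x y.

Section PathGraph.
Variable m : nat.

Definition path_adj : rel 'I_m :=
  fun i j => (i.+1 == j :> nat) || (j.+1 == i :> nat).

Lemma path_adj_sym : symmetric path_adj.
Proof. by move=> i j; rewrite /path_adj orbC. Qed.

Lemma path_adj_irrefl : irreflexive path_adj.
Proof. by move=> i; rewrite /path_adj orbb gtn_eqF. Qed.

Definition path_graph : sgraph := SGraph path_adj_sym path_adj_irrefl.
End PathGraph.

(* G is a copy of S_{a,b}; the two centres are distinct because adjacency is
   irreflexive. *)
Definition is_double_star (a b : nat) (G : sgraph) : Prop :=
  is_tree G /\
  exists u v : G,
    [/\ adj u v,
        [set x : G | ~~ leaf x] = [set u; v],
        #|[set x in nbrs u | leaf x]| = a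
      & #|[set x in nbrs v | leaf x]| = b].

Section Coalition.
Variable G : sgraph.
Implicit Types (A B S : {set G}) (P : {set {set G}}).

Definition two_dominating S : bool :=
  [forall v in ~: S, 2 <= #|nbrs v :&: S|].

Definition two_coalition A B : bool :=
  [&& [disjoint A & B], ~~ two_dominating A, ~~ two_dominating B
    & two_dominating (A :|: B)].

Definition two_coalition_partition P : bool :=
  partition P [set: G] &&
  [forall A in P,
     (two_dominating A && (#|A| == 2))
     || [exists B in P, (B != A) && two_coalition A B]].

(* The maximum is 0 if G has no 2-coalition partition. This does not occur for
   a tree with at least two vertices: if v is a leaf, {v} and its complement
   form such a partition. *)
Definition C2 : nat :=
  \max_(P : {set {set G}} | two_coalition_partition P) #|P|.
End Coalition.

(* Main.v *)
(** Let [P] be a 2-coalition partition with at least three classes.  Every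
    2-dominating set contains all leaves, so a class [A] containing a leaf is
    the partner of every other class and contains all leaves.  Since [A] is not
    2-dominating, some [v] outside [A] has at most one neighbor in [A]; every
    class [D] other than [A] and that of [v] must then contain a neighbor of
    [v], which is not a leaf.  Two adjacent non-leaves give [4 <= n].  If [P]
    has at least four classes, such a neighbor [u] of [v] must itself be
    2-dominated by [A] and a class not containing [v], so it has two neighbors
    other than [v]; in a tree all these vertices are distinct, whence
    [#|P|.*2 <= n].  Thus equality forces [n <= 3], or [n <= 5] with two
    adjacent non-leaves.  Conversely, in the latter case the leaves, the
    non-leaf neighbors of a non-leaf [u], and the other non-leaves form a
    2-coalition partition. *)
Require Import Defs.
From mathcomp Require Import all_boot zify.

Set Implicit Arguments.
Unset Strict Implicit.
Unset Printing Implicit Defensive.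

(** * Finite counting, leaves and coalitions *)

Lemma card_setD1_gt (I : finType) (S : {set I}) x m :
  m.+1 < #|S| -> m < #|S :\ x|.
Proof. by rewrite (cardsD1 x); case: (x \in S); lia. Qed.

Lemma uniq_full (I : finType) (s : seq I) :
  uniq s -> #|I| <= size s -> forall x, x \in s.
Proof.
move=> us cs x; have [||_ ->] := uniq_min_size us (s2 := enum I).
- by move=> y _; rewrite mem_enum.
- by rewrite -cardE.
by rewrite mem_enum.
Qed.

Lemma notin_short_seq (I : finType) (s : seq I) :
  size s < #|I| -> exists z, z \notin s.
Proof.
move=> cs; apply/existsP; apply: contraLR cs; rewrite negb_exists -leqNgt.
move=> /forallP alls; apply: leq_trans (card_size s); apply/subset_leq_card.
by apply/subsetP => x _; rewrite -[x \in s]negbK alls.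
Qed.

(** A vertex left out of [S] needs two neighbors, and a leaf has only one. *)
Lemma leaf_in_dominating (G : sgraph) (S : {set G}) x :
  two_dominating S -> leaf x -> x \in S.
Proof.
move=> /forallP /(_ x) + /eqP lx; rewrite inE.
case: (x \in S) => //= h2.
by move: (leq_trans h2 (subset_leq_card (subsetIl _ _))); rewrite lx.
Qed.

Lemma two_coalition_sym (G : sgraph) (A B : {set G}) :
  two_coalition A B = two_coalition B A.
Proof. by rewrite /two_coalition disjoint_sym setUC [X in _ && X]andbCA. Qed.

(** * Short closed walks and degrees in acyclic graphs *)

Section Acyclic.
Variables (G : sgraph) (acG : acyclic G).
Implicit Types x y z u v : G.

Let adjC := @adj_sym G.

Lemma adj_neq x y : adj x y -> x != y.
Proof. by apply: contraTneq => ->; rewrite adj_irrefl. Qed.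

Lemma no_long_cycle (c : seq G) : cycle (@adj G) c -> uniq c -> size c <= 2.
Proof. by move=> cc uc; apply: acG; rewrite /ucycle cc uc. Qed.

Lemma no_triangle x y z : adj x y -> adj y z -> ~~ adj x z.
Proof.
move=> xy yz; apply/negP => xz.
have := @no_long_cycle [:: x; y; z]; rewrite /= xy yz adjC xz !inE.
rewrite (negPf (adj_neq xy)) (negPf (adj_neq yz)) (negPf (adj_neq xz)).
by move=> /(_ isT isT).
Qed.

Lemma unique_common_nbr x y z t :
  adj x y -> adj y z -> adj z t -> adj t x -> x != z -> y = t.
Proof.
move=> xy yz zt tx nxz; apply/eqP; apply: contraT => nyt.
have := @no_long_cycle [:: x; y; z; t]; rewrite /= xy yz zt tx !inE.
rewrite (negPf (adj_neq xy)) (negPf (adj_neq yz)) (negPf (adj_neq zt)).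
rewrite (eq_sym x t) (negPf (adj_neq tx)) (negPf nxz) (negPf nyt).
by move=> /(_ isT isT).
Qed.

(** If two vertices two steps apart coincided, the other three steps would close a triangle; so the
    walk has five distinct vertices and is a forbidden cycle. *)
Lemma no_pentagon x y z t w :
  adj x y -> adj y z -> adj z t -> adj t w -> adj w x -> False.
Proof.
move=> xy yz zt tw wx.
have neq2 (a b c d : G) : adj b c -> adj c d -> adj d a -> a != b.
  move=> bc cd; apply: contraTneq => ->.
  by rewrite adjC; apply: no_triangle bc cd.
have := @no_long_cycle [:: x; y; z; t; w]; rewrite /= xy yz zt tw wx !inE.
rewrite (negPf (adj_neq xy)) (negPf (adj_neq yz)) (negPf (adj_neq zt)).
rewrite (negPf (adj_neq tw)) (eq_sym x w) (negPf (adj_neq wx)).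
rewrite (negPf (neq2 _ _ _ _ zt tw wx)) (negPf (neq2 _ _ _ _ tw wx xy)).
rewrite (negPf (neq2 _ _ _ _ wx xy yz)).
rewrite (eq_sym x t) (negPf (neq2 _ _ _ _ xy yz zt)).
rewrite (eq_sym y w) (negPf (neq2 _ _ _ _ yz zt tw)).
by move=> /(_ isT isT).
Qed.

(** The path grows at its head [x] by a neighbor [w] other than the second vertex. Were [w] already
    on the path, the stretch from [x] to [w], closed by their edge, would be a cycle of length at
    least three. *)
Lemma uniq_path_size_ge (y z : G) :
  (forall v, 1 < #|nbrs v|) -> forall m,
  exists x p, [/\ path (@adj G) x p, uniq (x :: p) & size p = m].
Proof.
move=> deg2; elim=> [|m [x [p [pp up sp]]]]; first by exists y, [::].
have [w xw wp] : exists2 w, adj x w & ohead p != Some w.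
  have /card_gt1P[a [b [+ + nab]]] := deg2 x; rewrite !inE => xa xb.
  case: (eqVneq (ohead p) (Some a)) => [->|]; last by exists a.
  by exists b.
exists w, (x :: p); split; [by rewrite /= adjC xw| |by rewrite /= sp].
rewrite cons_uniq up andbT inE negb_or eq_sym (adj_neq xw) /=.
apply/negP => wip; case/splitPr: wip pp up wp {sp} => p1 p2.
rewrite cat_path -cat_cons -(cat_rcons w (x :: p1)) cat_uniq rcons_cons.
move=> /andP[pp1 /andP[lw _]] /and3P[uc _ _].
case: p1 pp1 lw uc => [|a p1] pp1 lw uc; first by rewrite eqxx.
move=> _; have := @no_long_cycle (x :: rcons (a :: p1) w); rewrite uc.
rewrite /cycle !rcons_path pp1 lw last_rcons adjC xw /= size_rcons.
by move=> /(_ isT isT).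
Qed.

(** Otherwise there would be a path with [#|G|] edges, one vertex too many. *)
Lemma acyclic_low_degree : 0 < #|G| -> exists v : G, #|nbrs v| <= 1.
Proof.
case/card_gt0P => y _; apply/existsP; apply: contraT.
rewrite negb_exists => /forallP deg2.
have [v|x [p [_ up sp]]] := uniq_path_size_ge y y _ #|G|.
  by rewrite ltnNge.
by have := max_card (mem (x :: p)); rewrite (card_uniqP up) /= sp ltnn.
Qed.
End Acyclic.

(** * Degrees, leaves and adjacent non-leaves in a tree *)

Section Tree.
Variables (T : sgraph) (treeT : is_tree T) (T_gt1 : 1 < #|T|).
Implicit Types x y z u v : T.

Let adjC := @adj_sym T.
Let acT : acyclic T := proj2 treeT.

Lemma tree_degree_gt0 v : 0 < #|nbrs v|.
Proof.
have [y nyv] : exists y, y != v.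
  have /card_gt1P[a [b [_ _ nab]]] := T_gt1.
  by case: (eqVneq a v) => [<-|]; [exists b; rewrite eq_sym | exists a].
have /connectP[[|z p] /=] := proj2 (proj1 treeT) v y.
  by move=> _ eyv; rewrite eyv eqxx in nyv.
by case/andP => vz _ _; apply/card_gt0P; exists z; rewrite inE.
Qed.

Lemma tree_leaf : exists v : T, leaf v.
Proof.
have [v hv] := acyclic_low_degree acT (ltnW T_gt1).
by exists v; rewrite /leaf eqn_leq hv tree_degree_gt0.
Qed.

Lemma nonleaf_degree v : ~~ leaf v = (1 < #|nbrs v|).
Proof. by rewrite /leaf ltn_neqAle eq_sym tree_degree_gt0 andbT. Qed.

Lemma nonleaf_nbr_neq u v : ~~ leaf u -> exists2 a, adj u a & a != v.
Proof.
rewrite nonleaf_degree => /card_gt1P[a [b [+ + nab]]]; rewrite !inE => ua ub.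
by case: (eqVneq a v) => [<-|]; [exists b; rewrite 1?eq_sym | exists a].
Qed.

(** Each of [u] and [v] has a further neighbor; a shared one would close a triangle. *)
Lemma adjacent_nonleaves_path u v : adj u v -> ~~ leaf u -> ~~ leaf v ->
  exists a b, [/\ adj a u, adj v b & uniq [:: a; u; v; b]].
Proof.
move=> uv /nonleaf_nbr_neq-/(_ v)[a ua nav] /nonleaf_nbr_neq-/(_ u)[b vb nbu].
exists a, b; split; rewrite // 1?adjC // /= !inE.
rewrite eq_sym (negPf (adj_neq ua)) (negPf nav) (negPf (adj_neq uv)).
rewrite (eq_sym u) (negPf nbu) (negPf (adj_neq vb)) /= !andbT.
apply: contraTneq vb => <-; rewrite adjC.
by apply: contraTN uv => av; rewrite (no_triangle acT ua av).
Qed.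

Lemma adjacent_nonleaves_card u v :
  adj u v -> ~~ leaf u -> ~~ leaf v -> 4 <= #|T|.
Proof.
move=> uv lu lv; have [a [b [_ _ us]]] := adjacent_nonleaves_path uv lu lv.
by rewrite -[4](card_uniqP us) max_card.
Qed.

(** * Upper bound on the number of classes *)

Section Partition.
Variables (P : {set {set T}}) (copP : two_coalition_partition P).

Let partP : partition P [set: T]. Proof. by case/andP: copP. Qed.
Let tiP : trivIset P. Proof. by case/and3P: partP. Qed.
Let blockP x : pblock P x \in P.
Proof. by rewrite pblock_mem ?(cover_partition partP) ?inE. Qed.
Let in_block x : x \in pblock P x.
Proof. by rewrite mem_pblock (cover_partition partP) inE. Qed.
Let notin_block x D : D \in P -> D != pblock P x -> x \notin D.
Proof. by move=> DP; apply: contraNN => xD; rewrite (def_pblock tiP DP xD). Qed.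

Lemma coalition_hub : 2 < #|P| -> exists A v,
  [/\ A \in P, forall D, D \in P -> D != A -> two_dominating (A :|: D),
      forall x, leaf x -> x \in A, v \notin A & #|nbrs v :&: A| <= 1].
Proof.
move=> cP; have [l ll] := tree_leaf.
pose A := pblock P l.
have coal D : D \in P -> D != A -> two_coalition D A.
  move=> DP DA; have lD := notin_block DP DA.
  case/andP: copP => _ /forall_inP/(_ D DP) /orP[/andP[domD _]|].
    by rewrite (leaf_in_dominating domD ll) in lD.
  case/exists_inP => B BP /andP[_ coB]; have /and4P[_ _ _ domDB] := coB.
  have /setUP[lD'|lB] := leaf_in_dominating domDB ll.
    by rewrite lD' in lD.
  by rewrite /A (def_pblock tiP BP lB).
have AP : A \in P := blockP l.
have dom D : D \in P -> D != A -> two_dominating (A :|: D).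
  by move=> DP DA; case/and4P: (coal D DP DA); rewrite setUC.
(* Every leaf lies in both [A :|: D1] and [A :|: D2], hence in [A], as [D1] and [D2] are
   disjoint. *)
have [D1 [D2 [+ + nD]]] : exists D1 D2,
    [/\ D1 \in P :\ A, D2 \in P :\ A & D1 != D2].
  by apply/card_gt1P; apply: card_setD1_gt.
rewrite !inE => /andP[nD1 D1P] /andP[nD2 D2P].
have /and4P[_ _ + _] := coal D1 D1P nD1.
case/forall_inPn => v; rewrite inE -leqNgt => vA dv.
exists A, v; split=> // x lx.
have /setUP[//|xD1] := leaf_in_dominating (dom _ D1P nD1) lx.
have /setUP[//|xD2] := leaf_in_dominating (dom _ D2P nD2) lx.
by move: nD; rewrite -(def_pblock tiP D1P xD1) (def_pblock tiP D2P xD2) eqxx.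
Qed.

Lemma dominated_by (A D : {set T}) x : two_dominating (A :|: D) ->
  x \notin A -> x \notin D -> 2 <= #|nbrs x :&: A| + #|nbrs x :&: D|.
Proof.
move=> /forall_inP/(_ x); rewrite !inE => + xA xD.
rewrite (negPf xA) (negPf xD) setIUr => /(_ isT) le2.
by rewrite (leq_trans le2) // leq_card_setU.
Qed.

Lemma large_partition_adjacent_nonleaves : 2 < #|P| ->
  exists u v : T, [/\ adj u v, ~~ leaf u & ~~ leaf v].
Proof.
move=> cP; have [A [v [AP dom leafA vA dv]]] := coalition_hub cP.
have /card_gt0P[D] : 0 < #|P :\ A :\ pblock P v|.
  by do 2!apply: card_setD1_gt.
rewrite !inE => /and3P[Dv DA DP].
have vD := notin_block DP Dv.
have /card_gt0P[u] : 0 < #|nbrs v :&: D|.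
  by have := dominated_by (dom D DP DA) vA vD; lia.
rewrite !inE => /andP[vu uD]; exists u, v; split; first by rewrite adjC.
  apply: contraNN DA => /leafA uA.
  by rewrite -(def_pblock tiP DP uD) (def_pblock tiP AP uA).
by apply: contraNN vA => /leafA.
Qed.

Lemma card_partition_ge4 : 3 < #|P| -> #|P|.*2 <= #|T|.
Proof.
move=> cP; have [A [v [AP dom leafA vA dv]]] := coalition_hub (ltnW cP).
pose Q := P :\ A :\ pblock P v.
have cQ : #|P| = #|Q|.+2.
  rewrite (cardsD1 A) AP (cardsD1 (pblock P v)) !inE blockP andbT.
  by rewrite -/Q (contraNneq _ vA) // => <-.
pose M := nbrs v :\: A :\: pblock P v.
(* Sort [M] by classes: each class of [Q] must contribute at least the neighbors of [v] that [A]
   fails to supply. *)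
have cM : #|Q| * (2 - #|nbrs v :&: A|) <= #|M|.
  rewrite -(sum1_card (mem M)) (partition_big (pblock P) (mem Q)) /=;
    last first.
    move=> u; rewrite !inE => /and3P[uv uA _]; rewrite blockP andbT.
    apply/andP; split; last by apply: contraNneq uA => <-.
    by apply: contraNneq uv => <-.
  rewrite -sum_nat_const; apply: leq_sum => D; rewrite !inE => /and3P[Dv DA DP].
  have vD := notin_block DP Dv.
  have := dominated_by (dom D DP DA) vA vD.
  rewrite sum1_card -leq_subLR => /leq_trans -> //; apply: subset_leq_card.
  apply/subsetP => u; rewrite !inE => /andP[vu uD]; rewrite unfold_in /= !inE.
  rewrite (def_pblock tiP DP uD) eqxx vu !andbT.
  apply/andP; split.
    apply: contraNN Dv => uV.
    by rewrite -(def_pblock tiP DP uD) (def_pblock tiP (blockP v) uV).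
  apply: contraNN DA => uA.
  by rewrite -(def_pblock tiP DP uD) (def_pblock tiP AP uA).
(* [Q] has at least two classes, so one of them, [D], avoids [u]. Then [A :|: D] contains neither
   [u] nor [v] and holds two neighbors of [u]. *)
have degM u : u \in M -> 2 <= #|nbrs u :\ v|.
  rewrite !inE => /and3P[uv uA vu].
  have /card_gt0P[D] : 0 < #|Q :\ pblock P u|.
    by do 3!apply: card_setD1_gt.
  rewrite !inE => /and4P[Du Dv DA DP].
  have /forall_inP/(_ u) := dom D DP DA; rewrite !inE (negPf uA).
  rewrite (notin_block DP Du) => /(_ isT) /leq_trans -> //.
  apply: subset_leq_card; apply/subsetP => w; rewrite !inE.
  case/andP => -> wAD; rewrite andbT; apply: contraTneq wAD => ->.
  by rewrite negb_or vA notin_block.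
(* The value [set0] off [M] makes the sets pairwise disjoint over all vertices, as the counting of
   the union requires. *)
pose F u := if u \in M then nbrs u :\ v else set0.
pose W := \bigcup_u F u.
(* A vertex other than [v] adjacent to two members of [M] would close a four-cycle through [v]. *)
have cW : #|M|.*2 <= #|W|.
  rewrite -(sum1_card (mem W)).
  rewrite partition_disjoint_bigcup => [|u w nuw]; last first.
    rewrite -setI_eq0 -subset0; apply/subsetP => x.
    rewrite /F inE; case: ifP => [uM|]; last by rewrite !inE.
    case: ifP => [wM|]; last by rewrite !inE andbF.
    move: uM wM; rewrite !inE => /and3P[_ _ vu] /and3P[_ _ vw].
    case/andP => /andP[nxv ux] /andP[_ wx]; apply: contraNT nuw => _.
    apply/eqP; apply: (unique_common_nbr acT vu ux); rewrite 1?eq_sym //.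
      by rewrite adjC.
    by rewrite adjC.
  rewrite (bigID [in M]) /= -muln2 -sum_nat_const.
  apply: (leq_trans _ (leq_addr _ _)); apply: leq_sum => u uM.
  by rewrite sum1_card /F uM degM.
have WP w : w \in W -> exists u, [/\ adj v u, adj u w & w != v].
  case/bigcupP => u _; rewrite /F; case: ifP => [|_]; last by rewrite inE.
  by rewrite !inE => /and3P[_ _ vu] /andP[nw uw]; exists u.
have cN : #|nbrs v :&: A| + #|M| <= #|nbrs v|.
  by rewrite -(cardsID A (nbrs v)) leq_add2l subset_leq_card // subsetDl.
(* Count [v], its neighbors and [W]; a neighbor of [v] in [W] would close a triangle. *)
have : #|v |: (nbrs v :|: W)| <= #|T| by apply: max_card.
rewrite cardsU1 cardsU disjoint_setI0 ?cards0 ?subn0; last first.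
  rewrite -setI_eq0 -subset0; apply/subsetP => w; rewrite !inE.
  case/andP => vw /WP[u [vu uw _]].
  by rewrite (negPf (no_triangle acT vu uw)) in vw.
have -> : v \notin nbrs v :|: W.
  rewrite !inE adj_irrefl /=; apply/negP => /WP[u [_ _]].
  by rewrite eqxx.
(* With [a = #|nbrs v :&: A|] at most 1, the order is at least [1 + a + 3 * #|M|] and [#|M|] at
   least [(2 - a) * #|Q|]; as [#|Q|] is at least 2, this reaches [2 * (#|Q| + 2)]. *)
move: cP cM cN cW dv; rewrite cQ.
case: #|_ :&: A| => [|[|]] //; lia.
Qed.
End Partition.

(** * Partitions into two and three classes *)

Lemma C2_ge2 : 2 <= C2 T.
Proof.
have [l ll] := tree_leaf.
have [y] := card_gt0P (tree_degree_gt0 l); rewrite inE => ly.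
have nyl : y != l by rewrite eq_sym (adj_neq ly).
have nlC : [set l] != ~: [set l].
  by apply/negP => /eqP/setP/(_ l); rewrite !inE eqxx.
(* [[set l]] holds at most one neighbor of [y], and its complement misses the leaf [l]. *)
have coal : two_coalition [set l] (~: [set l]).
  apply/and4P; split.
  - by rewrite -setI_eq0 setICr.
  - apply/forall_inPn; exists y; first by rewrite !inE.
    by rewrite -ltnNge ltnS -(cards1 l) subset_leq_card // subsetIr.
  - by apply/negP => /leaf_in_dominating/(_ ll); rewrite !inE eqxx.
  - by rewrite setUCr; apply/forall_inP => x; rewrite !inE.
suff copP : two_coalition_partition [set [set l]; ~: [set l]].
  have := @leq_bigmax_cond _ _ (fun P : {set {set T}} => #|P|) _ copP.
  by rewrite cards2 nlC.
apply/andP; split.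
  apply/and3P; split.
  - by rewrite /cover bigcup_setU !big_set1 setUCr.
  - apply/trivIsetP => D E; rewrite !inE.
    by case/orP => /eqP-> /orP[]/eqP-> //; rewrite ?eqxx // => _;
       rewrite -setI_eq0 ?setICr // setIC setICr.
  - rewrite !inE !(eq_sym set0) negb_or -!card_gt0 cards1 /=.
    by apply/card_gt0P; exists y; rewrite !inE.
apply/forall_inP => D; rewrite !inE => /orP[]/eqP->; apply/orP; right;
  apply/exists_inP.
  by exists (~: [set l]); rewrite ?set22 // eq_sym nlC.
exists [set l]; rewrite ?set21 // nlC /=.
by rewrite two_coalition_sym.
Qed.

Lemma C2_ge3 u v : adj u v -> ~~ leaf u -> ~~ leaf v -> #|T| <= 5 -> 3 <= C2 T.
Proof.
move=> uv lu lv cT; have vu : adj v u by rewrite adjC.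
have [l ll] := tree_leaf.
pose L := [set x : T | leaf x].
pose B := [set x : T | ~~ leaf x && adj u x].
pose C := [set x : T | ~~ leaf x && ~~ adj u x].
have lL : l \in L by rewrite inE.
have vB : v \in B by rewrite inE lv.
have uC : u \in C by rewrite inE lu adj_irrefl.
have LB : [disjoint L & B].
  by rewrite -setI_eq0; apply/eqP/setP => x; rewrite !inE; case: (leaf x).
have LC : [disjoint L & C].
  by rewrite -setI_eq0; apply/eqP/setP => x; rewrite !inE; case: (leaf x).
have BC : [disjoint B & C].
  rewrite -setI_eq0; apply/eqP/setP => x; rewrite !inE.
  by case: (leaf x) => //=; rewrite andbN.
have disj_neq (D E : {set T}) x : [disjoint D & E] -> x \in D -> D != E.
  by move=> DE xD; apply/eqP => eDE; have := disjointFr DE xD; rewrite -eDE xD.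
have nLB := disj_neq _ _ _ LB lL; have nLC := disj_neq _ _ _ LC lL.
have nBC := disj_neq _ _ _ BC vB.
(* The vertices outside [D] are pairwise non-adjacent non-leaves, so all their neighbors, at least
   two each, lie in [D]. *)
have cap_dom (D E : {set T}) : (forall x, x \notin D -> x \in E) ->
    (forall x, x \in E -> ~~ leaf x) ->
    (forall x y, x \in E -> y \in E -> ~~ adj x y) -> two_dominating D.
  move=> DE El indE; apply/forall_inP => x; rewrite inE => /DE xE.
  have := El x xE; rewrite nonleaf_degree => /leq_trans -> //.
  apply: subset_leq_card; apply/subsetP => y; rewrite !inE => xy; rewrite xy.
  by apply: contraTT xy => /DE; apply: indE.
have domLB : two_dominating (L :|: B).
  apply: (@cap_dom _ C) => [x|x|x y].
  - by rewrite !inE; case: (leaf x).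
  - by rewrite inE => /andP[].
  (* If [x] and [y] in [C] were adjacent, then [u], [v], [a], [x], [y] would be all the vertices. *)
  rewrite !inE => /andP[lx ux] /andP[ly uy]; apply/negP => xy.
  have yx : adj y x by rewrite adjC.
  have nvx : v != x by apply: contraTneq uv => ->.
  have nvy : v != y by apply: contraTneq uv => ->.
  have [a ua nav] := nonleaf_nbr_neq v lu.
  have nax : a != x by apply: contraTneq ua => ->.
  have nay : a != y by apply: contraTneq ua => ->.
  have nux : u != x by apply: contraTneq xy => <-.
  have nuy : u != y by apply: contraTneq yx => <-.
  have us : uniq [:: u; v; a; x; y].
    rewrite /= !inE (negPf (adj_neq uv)) (negPf (adj_neq ua)).
    rewrite (negPf nux) (negPf nuy) /=.
    rewrite (eq_sym v a) (negPf nav) (negPf nvx) (negPf nvy) (negPf nax).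
    by rewrite (negPf nay) (negPf (adj_neq xy)).
  (* Besides [t], a neighbor of [z] can only be [v] or [a], both adjacent to [u]. Used for [x] and
     for [y], this gives a closed walk of length five through [u]. *)
  have toward_u z t : [:: x; y] =i [:: z; t] -> ~~ adj u z -> ~~ leaf z ->
      exists2 s, adj z s & adj u s.
    move=> exy uz lz; have [s zs nst] := nonleaf_nbr_neq t lz; exists s => //.
    have := uniq_full us cT s.
    rewrite -[_ :: _]/([:: u; v; a] ++ [:: x; y]) mem_cat exy !inE (negPf nst).
    rewrite orbF => /orP[/or3P[]|] /eqP es; rewrite es // in zs *.
      by rewrite adjC zs in uz.
    by rewrite adj_irrefl in zs.
  have [//|s xs us'] := toward_u x y _ ux lx.
  have [|t yt ut] := toward_u y x _ uy ly.
    by move=> z; rewrite !inE orbC.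
  by apply: (no_pentagon acT us' _ xy yt); rewrite adjC.
have domLC : two_dominating (L :|: C).
  apply: (@cap_dom _ B) => [x|x|x y].
  - by rewrite !inE; case: (leaf x); case: (adj u x).
  - by rewrite inE => /andP[].
  (* The members of [B] share the neighbor [u], so an edge between two of them would close a
     triangle. *)
  rewrite !inE => /andP[_ ux] /andP[_ uy]; rewrite adjC in ux.
  by apply: contraTN uy => xy; apply: (no_triangle acT) xy; rewrite adjC.
have not_dom (D : {set T}) : [disjoint L & D] -> ~~ two_dominating D.
  move=> LD; apply/negP => /leaf_in_dominating/(_ ll).
  by rewrite (disjointFr LD lL).
(* Otherwise [u] and [v] would have two leaf neighbors each, all distinct for lack of triangles,
   which makes six vertices. *)
have not_domL : ~~ two_dominating L.
  apply/negP => /forall_inP domL.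
  have du := domL u; have dv := domL v; rewrite !inE in du dv.
  have disj : [disjoint nbrs u :&: L & nbrs v :&: L].
    rewrite -setI_eq0; apply/eqP/setP => x; rewrite !inE; apply/negP.
    case/andP => /andP[ux _] /andP[vx _].
    by rewrite (negPf (no_triangle acT uv vx)) in ux.
  have := max_card (mem (u |: (v |: (nbrs u :&: L :|: nbrs v :&: L)))).
  rewrite !cardsU1 cardsU (disjoint_setI0 disj) cards0 subn0.
  rewrite !inE (negPf lu) (negPf lv) (negPf (adj_neq uv)) !andbF /=.
  move=> /leq_trans/(_ cT); rewrite !add1n !ltnS.
  by move/(leq_trans (leq_add (du lu) (dv lv))).
have not_domB := not_dom _ LB; have not_domC := not_dom _ LC.
have coLB : two_coalition L B by apply/and4P.
have coLC : two_coalition L C by apply/and4P.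
pose P := [set L; B; C].
have copP : two_coalition_partition P.
  apply/andP; split.
    apply/and3P; split.
    - rewrite /cover /P !bigcup_setU !big_set1; apply/eqP/setP => x.
      by rewrite !inE; case: (leaf x); case: (adj u x).
    - apply/trivIsetP => D E; rewrite !inE.
      by do 2![case/orP => [/orP[]|] /eqP->];
         rewrite ?eqxx ?LB ?LC ?BC // disjoint_sym ?LB ?LC ?BC.
    - rewrite !inE !negb_or -andbA; apply/and3P; split; apply/eqP => e0;
      [move: lL | move: vB | move: uC]; by rewrite -e0 inE.
  apply/forall_inP => D; rewrite !inE -orbA => /or3P[] /eqP->;
    apply/orP; right; apply/exists_inP.
  - by exists B; rewrite ?inE ?eqxx ?orbT // eq_sym nLB coLB.
  - by exists L; rewrite ?inE ?eqxx ?orbT // nLB two_coalition_sym coLB.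
  - by exists L; rewrite ?inE ?eqxx ?orbT // nLC two_coalition_sym coLC.
have := @leq_bigmax_cond _ _ (fun P : {set {set T}} => #|P|) _ copP.
by rewrite /P setUC cardsU1 cards2 nLB !inE negb_or !(eq_sym C) nLC nBC.
Qed.

(** * The bound and its equality case *)

Lemma C2_le : C2 T <= #|T| %/ 2 + 1.
Proof.
apply/bigmax_leqP => P copP.
(* Two classes fit since [#|T|] is at least 2; three classes force order at least 4, and from four
   classes on [#|P|.*2 <= #|T|]. *)
have [|cP] := leqP #|P| 2; first by move: T_gt1; lia.
have [u [v [uv lu lv]]] := large_partition_adjacent_nonleaves copP cP.
have c4 := adjacent_nonleaves_card uv lu lv.
have := card_partition_ge4 copP; lia.
Qed.

(** From order 4 on, equality requires at least three classes, hence adjacent non-leaves. Four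
    classes would contradict [#|P|.*2 <= #|T|], so there are exactly three and the order is at most
    5. *)
Lemma C2_eq_max : C2 T = #|T| %/ 2 + 1 <->
  #|T| <= 3 \/
  #|T| <= 5 /\ exists u v : T, [/\ adj u v, ~~ leaf u & ~~ leaf v].
Proof.
split=> [|[c3|[c5 [u [v [uv lu lv]]]]]]; last first.
- have := adjacent_nonleaves_card uv lu lv; have := C2_ge3 uv lu lv c5.
  have := C2_le; lia.
- have := C2_ge2; have := C2_le; lia.
have [|c4] := leqP #|T| 3; [by left | move=> eC; right].
(* The maximum is attained unless no partition exists, and then it is the default 0, which is not a
   successor. *)
have [P copP eP] : exists2 P : {set {set T}}, two_coalition_partition P &
    #|P| = #|T| %/ 2 + 1.
  have [P copP|noP] := pickP (@two_coalition_partition T).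
    rewrite -eC /C2.
    have [|Q copQ ->] := @eq_bigmax_cond _ (@two_coalition_partition T)
      (fun P : {set {set T}} => #|P|); last by exists Q.
    by apply/card_gt0P; exists P.
  by move: eC; rewrite /C2 big_pred0 ?addn1.
split; last by apply: (large_partition_adjacent_nonleaves copP); lia.
have := card_partition_ge4 copP; lia.
Qed.

End Tree.

(** * Hamiltonian paths in acyclic graphs *)

Lemma adj_consecutive (G : sgraph) (s : seq G) x y :
  acyclic G -> sorted (@adj G) s -> uniq s -> x \in s -> y \in s ->
  adj x y -> index x s < index y s -> index y s = (index x s).+1.
Proof.
move=> acG ss us xs ys xy; case/splitPr: xs ss us ys => p q ss us.
have {ss} xq : path (@adj G) x q.
  by case: p ss us => [|z p] //=; rewrite cat_path /= => /and3P[].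
move: us; rewrite cat_uniq mem_cat => /= /and3P[up /norP[xp _] uxq] ys.
rewrite !index_cat (negPf xp) /= eqxx addn0.
case: ifP ys => [yp _|_ /=]; first by rewrite ltnNge ltnW ?index_mem.
rewrite inE (negPf (adj_neq xy)) eq_sym; case: eqVneq => [eyx|_ /= yq _].
  by rewrite eyx adj_irrefl in xy.
case/splitPr: yq xq uxq => r t; rewrite -cat_rcons cat_path.
move=> /andP[xr _] /andP[xrt]; rewrite cat_uniq => /andP[ur _].
(* The stretch from [x] to [y], closed by their edge, is a cycle, so [r] is empty. *)
have := @no_long_cycle _ acG (x :: rcons r y).
rewrite /cycle rcons_path xr last_rcons adj_sym xy /=.
rewrite mem_cat negb_or in xrt; case/andP: xrt => -> _; rewrite ur size_rcons.
case: r {xr ur} => [|z r] /(_ isT isT) //= _; by rewrite eqxx addn1.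
Qed.

(** The isomorphism is the index in [s]: acyclicity excludes chords, so adjacent vertices are
    exactly the consecutive ones. *)
Lemma hamiltonian_path_iso (G : sgraph) (s : seq G) m :
  acyclic G -> sorted (@adj G) s -> uniq s -> size s = m -> #|G| = m ->
  graph_iso G (path_graph m).
Proof.
move=> acG ss us sm cG.
have alls x : x \in s by apply: uniq_full; rewrite ?cG ?sm.
have is_m x : index x s < m by rewrite -sm index_mem.
pose f x : path_graph m := Ordinal (is_m x).
exists f.
  apply: inj_card_bij => [x y [exy]|]; last by rewrite card_ord cG.
  by rewrite -(nth_index x (alls x)) exy nth_index.
have step x y : (index x s).+1 = index y s -> adj x y.
  move=> exy; rewrite -(nth_index x (alls x)) -(nth_index x (alls y)) -exy.
  by move/(sortedP x): ss; apply; rewrite exy index_mem.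
have consec x y :
  adj x y -> index x s < index y s -> (index x s).+1 = index y s.
  by move=> xy lxy; rewrite (adj_consecutive acG ss us _ _ xy lxy).
move=> x y; rewrite /= /path_adj /=; apply/orP/idP.
  by case=> /eqP /step //; rewrite adj_sym.
move=> xy; case: (ltngtP (index x s) (index y s)) => h.
- by left; rewrite (consec x y).
- by right; rewrite (consec y x) // adj_sym.
have := adj_neq xy; rewrite -(nth_index x (alls x)) h nth_index //.
by rewrite eqxx.
Qed.

(** * Classification of trees of order at most five *)

Section SmallTrees.
Variables (T : sgraph) (treeT : is_tree T) (T_gt1 : 1 < #|T|).
Implicit Types x y z u v : T.

Let adjC := @adj_sym T.
Let acT : acyclic T := proj2 treeT.

Lemma tree_card2_iso : #|T| = 2 -> graph_iso T (path_graph 2).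
Proof.
move=> c2; have [x _] : exists x : T, true.
  by have /card_gt0P[x _] := ltnW T_gt1; exists x.
have /card_gt0P[y] := tree_degree_gt0 treeT T_gt1 x; rewrite inE => xy.
apply: (@hamiltonian_path_iso _ [:: x; y]) => //=; first by rewrite xy.
by rewrite inE (adj_neq xy).
Qed.

Lemma tree_card3_iso : #|T| = 3 -> graph_iso T (path_graph 3).
Proof.
move=> c3; have [x _] : exists x : T, true.
  by have /card_gt0P[x _] := ltnW T_gt1; exists x.
have /card_gt0P[y] := tree_degree_gt0 treeT T_gt1 x; rewrite inE => xy.
have [|z] := @notin_short_seq T [:: x; y]; first by rewrite c3.
rewrite !inE negb_or => /andP[nzx nzy].
have us : uniq [:: z; x; y] by rewrite /= !inE negb_or nzx nzy adj_neq.
have /card_gt0P[w] := tree_degree_gt0 treeT T_gt1 z; rewrite inE => zw.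
have := uniq_full us _ w; rewrite c3 !inE => /(_ isT) /or3P[] /eqP ew;
  rewrite {}ew in zw.
- by rewrite adj_irrefl in zw.
- by apply: (@hamiltonian_path_iso _ [:: z; x; y]); rewrite //= ?zw ?xy.
apply: (@hamiltonian_path_iso _ [:: z; y; x]); rewrite //= ?zw 1?adjC ?xy //.
by rewrite !inE negb_or nzx nzy eq_sym adj_neq.
Qed.

Lemma tree_card4_iso u v : adj u v -> ~~ leaf u -> ~~ leaf v ->
  #|T| = 4 -> graph_iso T (path_graph 4).
Proof.
move=> uv lu lv c4.
have [a [b [au vb us]]] := adjacent_nonleaves_path treeT T_gt1 uv lu lv.
by apply: (@hamiltonian_path_iso _ [:: a; u; v; b]); rewrite //= au uv vb.
Qed.

(** Any edge beyond the four given would close a triangle or a four-cycle, so [w], [a] and [b] are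
    leaves. The center with a single leaf is [v]. *)
Lemma double_star_1_2 a w u v b : adj u v -> adj a u -> adj w u -> adj v b ->
  uniq [:: w; a; u; v; b] -> #|T| = 5 -> is_double_star 1 2 T.
Proof.
move=> uv au wu vb us c5; split=> //; exists v, u.
have full x : x \in [:: w; a; u; v; b] by apply: uniq_full; rewrite ?c5.
have [vu ua uw bv] : [/\ adj v u, adj u a, adj u w & adj b v].
  by rewrite !(adjC v u, adjC u a, adjC u w, adjC b v).
move: us; rewrite /= !inE !negb_or -!andbA.
case/andP=> nwa /andP[nwu /andP[nwv /andP[nwb /andP[nau /andP[nav]]]]].
case/andP=> nab /andP[nuv /andP[nub /andP[nvb _]]].
have nadj (x y z : T) : adj x y -> adj y z -> adj x z = false.
  by move=> xy yz; exact: negPf (no_triangle acT xy yz).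
have far (x : T) : adj x u -> x != v -> adj x b = false.
  move=> xu nxv; apply: contraNF nub => xb; apply/eqP.
  by apply: (unique_common_nbr acT xu uv vb) nxv; rewrite adjC.
have only (x y : T) :
    all (fun z => adj x z ==> (z == y)) [:: w; a; u; v; b] -> leaf x.
  move=> /allP xy; rewrite /leaf eqn_leq tree_degree_gt0 // andbT -(cards1 y).
  apply/subset_leq_card/subsetP => z; rewrite !inE.
  by apply: implyP; apply: xy; apply: full.
have la : leaf a.
  apply: (only _ u); rewrite /= adj_irrefl (nadj _ _ _ au uw) eqxx implybT.
  by rewrite (nadj _ _ _ au uv) far.
have lw : leaf w.
  apply: (only _ u); rewrite /= adj_irrefl (nadj _ _ _ wu ua) eqxx implybT.
  by rewrite (nadj _ _ _ wu uv) far.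
have lb : leaf b.
  apply: (only _ v); rewrite /= adj_irrefl (nadj _ _ _ bv vu) eqxx implybT.
  by rewrite !(adjC b) !far.
have lu : ~~ leaf u.
  by rewrite nonleaf_degree //; apply/card_gt1P; exists a, v; rewrite !inE.
have lv : ~~ leaf v.
  by rewrite nonleaf_degree //; apply/card_gt1P; exists u, b; rewrite !inE.
have setE (A B : {set T}) :
    all (fun x => (x \in A) == (x \in B)) [:: w; a; u; v; b] -> A = B.
  by move=> /allP AB; apply/setP => x; apply/eqP/AB/full.
have neqs := (negPf nwa, negPf nwu, negPf nwv, negPf nwb, negPf nau, negPf nav,
  negPf nab, negPf nuv, negPf nub, negPf nvb).
have leafs := (la, lw, lb, negPf lu, negPf lv, @eqxx T).
have nvw : adj v w = false by rewrite adjC (nadj _ _ _ wu uv).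
have nva : adj v a = false by rewrite adjC (nadj _ _ _ au uv).
have nub' : adj u b = false by rewrite (nadj _ _ _ uv vb).
split=> //.
- by apply: setE; rewrite /= !inE !leafs (eq_sym b) (eq_sym b) !neqs.
- have -> : [set x in nbrs v | leaf x] = [set b]; last by rewrite cards1.
  by apply: setE; rewrite /= !inE !leafs !neqs nvw nva vb !andbF.
have -> : [set x in nbrs u | leaf x] = [set w; a]; last by rewrite cards2 nwa.
apply: setE; rewrite /= !inE !leafs (eq_sym a) (eq_sym u) (eq_sym u) (eq_sym v).
by rewrite (eq_sym v) (eq_sym b) (eq_sym b) !neqs nub' uw ua !andbF.
Qed.

(** The fifth vertex [w] attaches to the path [a], [u], [v], [b]: at an end this gives a longer
    path, at an inner vertex a double star. *)
Lemma tree_card5_cases u v : adj u v -> ~~ leaf u -> ~~ leaf v ->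
  #|T| = 5 -> graph_iso T (path_graph 5) \/ is_double_star 1 2 T.
Proof.
move=> uv lu lv c5.
have [a [b [au vb us]]] := adjacent_nonleaves_path treeT T_gt1 uv lu lv.
have [|w nws] := @notin_short_seq T [:: a; u; v; b]; first by rewrite c5.
have uws : uniq [:: w; a; u; v; b] by rewrite cons_uniq nws us.
have /card_gt0P[t] := tree_degree_gt0 treeT T_gt1 w; rewrite inE => wt.
have := uniq_full uws _ t; rewrite c5 !inE => /(_ isT).
case/or4P => [||| /orP[]] /eqP et; rewrite {}et in wt.
- by rewrite adj_irrefl in wt.
- left; apply: (@hamiltonian_path_iso _ [:: w; a; u; v; b]) => //=.
  by rewrite wt au uv vb.
- by right; apply: (@double_star_1_2 a w u v b).
- right; apply: (@double_star_1_2 b w v u a) => //; rewrite 1?adjC //.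
  rewrite -[uniq _]/(uniq (w :: rev [:: a; u; v; b])).
  by rewrite cons_uniq mem_rev rev_uniq nws us.
left; apply: (@hamiltonian_path_iso _ [:: a; u; v; b; w]) => //.
  by rewrite /= au uv vb adjC wt.
by rewrite -[uniq _]/(uniq (rcons [:: a; u; v; b] w)) rcons_uniq nws us.
Qed.

(** * Order and adjacent non-leaves of the listed trees *)

Lemma leaf_unique_nbr x y z : leaf x -> adj x y -> adj x z -> y = z.
Proof.
case/cards1P => t xt xy xz.
have : y \in nbrs x by rewrite inE.
have : z \in nbrs x by rewrite inE.
by rewrite xt !inE => /eqP-> /eqP->.
Qed.

(** Two adjacent leaves would form a whole component, leaving no room for the non-leaf [u]. *)
Lemma leaf_nbr_nonleaf u x y : ~~ leaf u -> leaf x -> adj x y -> ~~ leaf y.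
Proof.
move=> lu lx xy; apply: contraNN lu => ly.
have cl : closed (@adj T) (pred2 x y).
  apply: intro_closed => [|s t st]; first exact: sym_connect_sym adjC.
  rewrite !inE => /orP[]/eqP es; rewrite {}es in st.
    by rewrite (leaf_unique_nbr lx xy st) eqxx orbT.
  by rewrite adjC in xy; rewrite (leaf_unique_nbr ly xy st) eqxx.
have := closed_connect cl (proj2 (proj1 treeT) x u).
by rewrite !inE eqxx => /esym/orP[]/eqP->.
Qed.

(** Every leaf hangs on a center, so two centers and their one and two leaves exhaust the tree. *)
Lemma double_star_1_2_card : is_double_star 1 2 T -> #|T| <= 5.
Proof.
case=> _ [u [v [uv nl lu lv]]].
have inner x : (~~ leaf x) = (x \in [set u; v]) by rewrite -nl inE.
have : [set: T] \subset [set u; v] :|: ([set x in nbrs u | leaf x] :|: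
    [set x in nbrs v | leaf x]).
  apply/subsetP => x _; rewrite in_setU -inner.
  case lx: (leaf x) => //=.
  have /card_gt0P[y] := tree_degree_gt0 treeT T_gt1 x; rewrite inE => xy.
  have : ~~ leaf y by apply: (@leaf_nbr_nonleaf u) lx xy; rewrite inner set21.
  by rewrite inner !inE lx !andbT => /orP[]/eqP <-; rewrite (adjC y) xy ?orbT.
move/subset_leq_card; rewrite cardsT => /leq_trans -> //.
apply: leq_trans (leq_card_setU _ _) _; rewrite cards2 (adj_neq uv).
apply: (@leq_add _ _ 2 3) => //; apply: leq_trans (leq_card_setU _ _) _.
by rewrite lu lv.
Qed.

Lemma path_iso_adjacent_nonleaves m : 3 < m -> graph_iso T (path_graph m) ->
  exists u v : T, [/\ adj u v, ~~ leaf u & ~~ leaf v].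
Proof.
case: m => [|[|[|[|m]]]] // _ [f [g fK gK] fadj].
have gadj i j : adj (g i) (g j) = path_adj i j by rewrite -fadj !gK.
have gnl (i j k : 'I_m.+4) :
    path_adj i j -> path_adj i k -> j != k -> ~~ leaf (g i).
  move=> ij ik njk; rewrite nonleaf_degree //; apply/card_gt1P.
  by exists (g j), (g k); rewrite !inE !gadj (can_eq gK).
exists (g (inord 1)), (g (inord 2)); split.
- by rewrite gadj /path_adj !inordK.
- apply: (gnl _ (inord 0) (inord 2)); rewrite /path_adj -?val_eqE /= !inordK //.
- apply: (gnl _ (inord 1) (inord 3)); rewrite /path_adj -?val_eqE /= !inordK //.
Qed.
End SmallTrees.

Lemma path_iso_card (G : sgraph) m : graph_iso G (path_graph m) -> #|G| = m.
Proof. by case=> f /bij_eq_card ->; rewrite card_ord. Qed.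

Unset Implicit Arguments.

Theorem theorem3p2 (T : sgraph) (n : nat) (hT : is_tree T)
    (hcard : #|T| = n) (hn : 2 <= n) :
  C2 T <= n %/ 2 + 1 /\
  (C2 T = n %/ 2 + 1 <->
     [\/ graph_iso T (path_graph 2), graph_iso T (path_graph 3),
         graph_iso T (path_graph 4)
       | graph_iso T (path_graph 5) \/ is_double_star 1 2 T]).
Proof.
move: hn; rewrite -{n}hcard => hn; split; first exact: C2_le.
(* It remains to match order at most 3, or order at most 5 with adjacent non-leaves, with the list
   of trees. *)
rewrite (C2_eq_max hT hn); split=> [[c3|[c5 [u [v [uv lu lv]]]]]|].
- case: (ltngtP #|T| 2) => c2; first by lia.
    by apply: Or42; apply: tree_card3_iso => //; lia.
  by apply: Or41; apply: tree_card2_iso.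
- have c4 := adjacent_nonleaves_card hT hn uv lu lv.
  case: (ltngtP #|T| 4) => e4; first by lia.
    by apply: Or44; apply: (tree_card5_cases hT hn uv lu lv); lia.
  by apply: Or43; apply: (tree_card4_iso hT hn uv lu lv).
case=> [iso|iso|iso|[iso|star]].
- by left; rewrite (path_iso_card iso).
- by left; rewrite (path_iso_card iso).
- right; rewrite (path_iso_card iso); split=> //.
  exact: path_iso_adjacent_nonleaves iso.
- right; rewrite (path_iso_card iso); split=> //.
  exact: path_iso_adjacent_nonleaves iso.
right; split; first exact: double_star_1_2_card.
have [_ [u [v [uv nl _ _]]]] := star; exists u, v; split=> //.
  by have := set21 u v; rewrite -nl inE.
by have := set22 u v; rewrite -nl inE.
Qed.
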